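(* Let $(\mathbb{S},\Sigma)$ be a measurable space, $\mu\in\mathcal{M}(\mathbb{S})$, and $\{f,f^{(n)}\}_{n=1,2,\ldots}\subset L^1(\mathbb{S};\mu)$. Then the equality $$\lim_{n\to\infty}\ \sup_{S\in\Sigma}\left|\int_S f^{(n)}(s)\,\mu(ds)-\int_S f(s)\,\mu(ds)\right|=0$$ holds if and only if the following two statements hold: (i) the sequence $\{f^{(n)}\}_{n=1,2,\ldots}$ converges in measure $\mu$ to $f$, and, therefore (as a consequence), there is a subsequence $\{f^{(n_k)}\}_{k=1,2,\ldots}$ of $\{f^{(n)}\}_{n=1,2,\ldots}$ that converges $\mu$-a.e. to $f$; (ii) the sequence $\{f^{(n)}\}_{n=1,2,\ldots}$ is uniformly integrable, that is, $$\lim_{K\to+\infty}\ \sup_{n=1,2,\ldots}\int_{\{s\in\mathbb{S}:\,|f^{(n)}(s)|\ge K\}}|f^{(n)}(s)|\,\mu(ds)=0.$$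
   Context: $\mathcal{M}(\mathbb{S})$ is the family of finite (nonnegative) measures on $(\mathbb{S},\Sigma)$. Functions $f:\mathbb{S}\to\overline{\mathbb{R}}:=\mathbb{R}\cup\{\pm\infty\}$ are called measurable if $\{s\in\mathbb{S}: f(s)<\alpha\}\in\Sigma$ for each $\alpha\in\mathbb{R}$. $L^1(\mathbb{S};\mu)$ is the set of all measurable functions $g:\mathbb{S}\to\overline{\mathbb{R}}$ with $\int_{\mathbb{S}}|g(s)|\,\mu(ds)<+\infty$. Convergence in measure $\mu$ of $f^{(n)}$ to $f$ means $\mu(\{s\in\mathbb{S}:|f^{(n)}(s)-f(s)|\ge\varepsilon\})\to0$ as $n\to\infty$ for each $\varepsilon>0$ (note that functions in $L^1(\mathbb{S};\mu)$ are finite $\mu$-a.e.). *)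

(* Defs.v *)
From HB Require Import structures.
From mathcomp Require Import all_boot all_order all_algebra.
From mathcomp Require Import all_classical all_reals all_analysis.

Set Implicit Arguments.
Unset Strict Implicit.
Unset Printing Implicit Defensive.

Import Order.TTheory GRing.Theory Num.Theory.
Import numFieldNormedType.Exports.

Local Open Scope classical_set_scope.
Local Open Scope ring_scope.
Local Open Scope ereal_scope.

(* The difference f_ n x - f x of two infinite values of the same sign is -oo
   by convention in \bar R, so that its absolute value is +oo.  For functions
   that are finite mu-almost everywhere this only affects a mu-null set. *)
Definition cvg_in_measure (R : realType) (d : measure_display)
    (T : measurableType d) (mu : {measure set T -> \bar R})
    (f_ : nat -> T -> \bar R) (f : T -> \bar R) : Prop :=
  forall eps : R, (0 < eps)%R ->
    mu [set x | eps%:E <= `|f_ n x - f x|] @[n --> \oo] --> 0.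

Definition uniformly_integrable (R : realType) (d : measure_display)
    (T : measurableType d) (mu : {measure set T -> \bar R})
    (f_ : nat -> T -> \bar R) : Prop :=
  ereal_sup (range (fun n : nat =>
      \int[mu]_(x in [set x | K%:E <= `|f_ n x|]) `|f_ n x|))
    @[K --> +oo%R] --> 0.

(* Main.v *)
Require Import Defs.
From mathcomp Require Import all_boot all_order all_algebra.
From mathcomp Require Import all_classical all_reals all_analysis.
From mathcomp Require Import measurable_realfun lra.

Set Implicit Arguments.
Unset Strict Implicit.
Unset Printing Implicit Defensive.

Import Order.TTheory GRing.Theory Num.Theory.
Import numFieldNormedType.Exports.

Local Open Scope classical_set_scope.
Local Open Scope ring_scope.
Local Open Scope ereal_scope.

(** Both sides of the equivalence are governed by the distance in mean
    [e_n = \int |f_n - f|].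

    The supremum over measurable sets is comparable to it: the supremum is at
    most [e_n], and [e_n] is at most twice the supremum, by testing on the set
    where [f_n - f] is nonnegative and on its complement
    ([cvg_L1_total_variation]).  What remains is Vitali's convergence theorem.

    If [e_n] tends to 0, Markov's inequality gives convergence in measure
    ([cvg_L1_in_measure]).  For uniform integrability, where [|f_n| >= K] either
    [|f| >= K / 2], or [|f_n - f|] is at least half of [|f_n|]; hence the tail
    of [f_n] at height [K] is at most [3 e_n] plus the tail of [f] at height
    [K / 2] ([tail_integral_perturb]).  This handles all large [n], and each of
    the finitely many other [f_n] is integrable, so its own tail vanishes
    ([cvg_L1_uniformly_integrable]).

    Conversely, [|f_n - f|] is below [eps] off the set [A] where it is at least
    [eps]; on [A] it is at most [|f_n| + |f|], and each of these two integrates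
    over [A] to at most [K mu(A)] plus a tail at height [K].  So [e_n] is at
    most [eps mu(T) + 2 K mu(A)] plus two tails ([L1_le_tails]).  One chooses
    [eps], then [K] by uniform integrability, then [n] by convergence in measure
    ([in_measure_uniformly_integrable_cvg_L1]); finiteness of [mu] enters in the
    first term.

    The almost everywhere convergent subsequence is F. Riesz's: pick [k j] with
    [|f_(k j) - f| >= 1/(j+1)] only on a set of measure at most [2^-(j+1)], and
    apply the Borel-Cantelli lemma ([cvg_in_measure_ae_subseq]).

    Integrands may be infinite.  The convention [oo - oo = -oo] makes
    [|g - f| = +oo] wherever [f] or [g] is infinite, so that the pointwise
    inequalities above hold everywhere and no null set has to be removed before
    integrating. *)

(** * Convergence to zero of nonnegative extended reals *)

Lemma ge0_cvge0P (R : realType) (I : Type) (F : set_system I) (u : I -> \bar R) :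
  Filter F -> (forall i, 0 <= u i) ->
  u i @[i --> F] --> 0 <->
  forall e : R, (0 < e)%R -> \forall i \near F, u i <= e%:E.
Proof.
move=> FF u0; split=> [|ule].
  move=> /fine_cvgP[ufin /cvgr0Pnorm_le ucvg] e e0.
  near=> i.
  rewrite -[leLHS]fineK ?lee_fin; last by near: i; exact: ufin.
  apply: (le_trans (ler_norm _)).
  by near: i; exact: ucvg.
have ufin (e : R) i : u i <= e%:E -> u i \is a fin_num.
  by move=> ue; rewrite ge0_fin_numE// (le_lt_trans ue)// ltry.
apply/fine_cvgP; split.
  by near=> i; apply: (ufin 1%R); near: i; exact: ule.
apply/cvgr0Pnorm_le => e e0; near=> i.
have ue : u i <= e%:E by near: i; exact: ule.
rewrite /= ger0_norm ?fine_ge0// -lee_fin fineK//.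
exact: ufin ue.
Unshelve. all: by end_near. Qed.

(** * Tails of integrals *)

Section truncation.
Context (R : realType) (d : measure_display) (T : measurableType d)
        (mu : {measure set T -> \bar R}).
Implicit Types f g h : T -> \bar R.

Definition tail_integral g (K : R) : \bar R :=
  \int[mu]_(x in [set x | K%:E <= `|g x|]) `|g x|.

Lemma measurable_abse_ge g (K : R) : measurable_fun [set: T] g ->
  measurable [set x | K%:E <= `|g x|].
Proof.
move=> mg; rewrite -[X in measurable X]setTI.
by apply: emeasurable_fun_c_infty => //; exact: measurableT_comp.
Qed.

Lemma tail_integral_ge0 g K : 0 <= tail_integral g K.
Proof. exact: integral_ge0. Qed.

Lemma le_tail_integral g (K L : R) : measurable_fun [set: T] g ->
  (K <= L)%R -> tail_integral g L <= tail_integral g K.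
Proof.
move=> mg KL; apply: ge0_subset_integral => //.
- exact: measurable_abse_ge.
- exact: measurable_abse_ge.
- by apply: measurable_funTS; exact: measurableT_comp.
- by move=> x /=; apply: le_trans; rewrite lee_fin.
Qed.

Lemma ge0_integral_setID (A B : set T) h :
  measurable A -> measurable B -> measurable_fun [set: T] h ->
  (forall x, 0 <= h x) ->
  \int[mu]_(x in A) h x =
  \int[mu]_(x in A `&` B) h x + \int[mu]_(x in A `\` B) h x.
Proof.
move=> mA mB mh h0; rewrite -[in LHS](setUIDK A B).
rewrite ge0_integral_setU//.
- exact: measurableI.
- exact: measurableD.
- exact: measurable_funTS.
- by apply/disj_setPS => x [[_ Bx] [_]].
Qed.

(** The truncations of [|g|] to the sets [|g| >= n + 1] are dominated by [|g|]
    and vanish eventually at every point where [g] is finite, that is, almost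
    everywhere. *)
Lemma tail_integral_cvg0 g : mu.-integrable [set: T] g ->
  forall e : R, (0 < e)%R ->
  exists2 K : R, (0 < K)%R & tail_integral g K <= e%:E.
Proof.
move=> ig e e0.
have mg := measurable_int _ ig.
pose B n := [set x | n.+1%:R%:E <= `|g x|].
have mB n : measurable (B n) by exact: measurable_abse_ge.
have [|||||_ _] := @dominated_convergence _ _ _ mu [set: T] measurableT
  (fun n => (abse \o g) \_ (B n)) (cst 0) (abse \o g).
- move=> n; apply/(measurable_restrictT _ (mB n)).
  by apply: measurable_funTS; exact: measurableT_comp.
- exact: measurable_cst.
- apply: filterS (integrable_ae measurableT ig) => x /(_ I) gx _.
  apply: cvg_near_cst; near=> n.
  rewrite patchE memNset//= /B/=; apply/negP; rewrite -ltNge.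
  rewrite -[ltLHS]fineK ?abse_fin_num// lte_fin.
  rewrite (@lt_trans _ _ n%:R)// ?ltr_nat//.
  by near: n; exact: nbhs_infty_gtr.
- exact: integrable_abse.
- apply: aeW => x n _; rewrite patchE; case: ifP => _ /=; first by rewrite abse_id.
  by rewrite normr0 abse_ge0.
rewrite integral0 => /ge0_cvge0P -/(_ _ e e0) [].
  by move=> n; apply: integral_ge0 => x _; rewrite patchE; case: ifP => //= _.
move=> N _ /(_ N (leqnn N)) /=.
rewrite -integral_mkcond => ?; exists N.+1%:R => //.
Unshelve. all: by end_near. Qed.

(** On the set where [|g| >= K], either [|f| >= K / 2] and the triangle
    inequality is used, or [|f| < K / 2 <= |g| / 2] and so
    [|g| <= 2 |g - f|]. *)
Lemma tail_integral_perturb f g (K : R) :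
  measurable_fun [set: T] f -> measurable_fun [set: T] g ->
  tail_integral g K <=
  3%:E * \int[mu]_x `|g x - f x| + tail_integral f (K / 2).
Proof.
move=> mf mg.
pose A := [set x | K%:E <= `|g x|]; pose B := [set x | (K / 2)%:E <= `|f x|].
have mA : measurable A by exact: measurable_abse_ge.
have mB : measurable B by exact: measurable_abse_ge.
have mAB : measurable (A `&` B) by exact: measurableI.
have mAD : measurable (A `\` B) by exact: measurableD.
have mabsf : measurable_fun [set: T] (abse \o f) by exact: measurableT_comp.
have mabsg : measurable_fun [set: T] (abse \o g) by exact: measurableT_comp.
have mgf : measurable_fun [set: T] (fun x => `|g x - f x|).
  by apply: measurableT_comp => //; exact: emeasurable_funB.
(* This holds even at infinite values, where [|g x - f x|] is [+oo]. *)
have abs_tri x : `|g x| <= `|g x - f x| + `|f x|.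
  by case: (g x) => [r| |]; case: (f x) => [s| |]//=;
    rewrite ?leey// lee_fin -{1}(subrK s r) ler_normD.
rewrite /tail_integral (ge0_integral_setID mA mB)//.
have I1 : \int[mu]_(x in A `&` B) `|g x| <=
    \int[mu]_x `|g x - f x| + \int[mu]_(x in B) `|f x|.
  apply: (@le_trans _ _ (\int[mu]_(x in A `&` B) (`|g x - f x| + `|f x|))).
    apply: ge0_le_integral => //.
    - exact: measurable_funTS.
    - by apply: measurable_funTS; exact: emeasurable_funD.
  rewrite ge0_integralD//; last 2 first.
    - exact: measurable_funTS.
    - exact: measurable_funTS.
  by apply: leeD; apply: ge0_subset_integral => //; exact: measurable_funTS.
have I2 : \int[mu]_(x in A `\` B) `|g x| <= 2%:E * \int[mu]_x `|g x - f x|.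
  rewrite -ge0_integralZl//.
  apply: (@le_trans _ _ (\int[mu]_(x in A `\` B) (2%:E * `|g x - f x|))).
    apply: ge0_le_integral => //.
    - exact: measurable_funTS.
    - apply: measurable_funTS; exact: measurable_funeM.
    - move=> x [/= Ax /negP]; rewrite -ltNge => Bx.
      move: Ax Bx; rewrite /A /= mule_natl mule2n.
      case: (f x) => [s| |]//=; case: (g x) => [r| |]//=.
      rewrite !lee_fin lte_fin => Kr sK.
      have := ler_normD (r - s)%R s; rewrite subrK; lra.
  apply: ge0_subset_integral => //; exact: measurable_funeM.
apply: (le_trans (leeD I1 I2)).
rewrite addeAC leeD2r//.
have -> : (3%:E : \bar R) = 1 + 2%:E by rewrite -EFinD; congr _%:E; lra.
by rewrite ge0_muleDl// mul1e.
Qed.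

(** Together with smallness of the tail, this is the uniform absolute continuity
    of the integrals of a uniformly integrable family. *)
Lemma integral_le_tail g (A : set T) (K : R) : measurable A ->
  measurable_fun [set: T] g -> (0 <= K)%R ->
  \int[mu]_(x in A) `|g x| <= K%:E * mu A + tail_integral g K.
Proof.
move=> mA mg K0.
have mB : measurable [set x | K%:E <= `|g x|] by exact: measurable_abse_ge.
have mabsg : measurable_fun [set: T] (abse \o g) by exact: measurableT_comp.
rewrite (ge0_integral_setID mA mB)// addeC; apply: leeD.
  rewrite -integral_cst//.
  have mAD := measurableD mA mB.
  apply: (@le_trans _ _
    (\int[mu]_(x in A `\` [set x | K%:E <= `|g x|]) K%:E)).
    apply: ge0_le_integral => //; first exact: measurable_funTS.
    by move=> x [_ /negP]; rewrite -ltNge => /ltW.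
  by apply: ge0_subset_integral.
apply: ge0_subset_integral => //; last by exact: measurable_funTS.
exact: measurableI.
Qed.

(** The quantitative core of Vitali's theorem: the integrand is at most [eps]
    outside the set [A] where [|g - f| >= eps], while on [A] the functions [f]
    and [g] are bounded separately. *)
Lemma L1_le_tails f g (eps K : R) :
  measurable_fun [set: T] f -> measurable_fun [set: T] g ->
  (0 <= eps)%R -> (0 <= K)%R ->
  \int[mu]_x `|g x - f x| <=
    eps%:E * mu [set: T] + (2 * K)%:E * mu [set x | eps%:E <= `|g x - f x|] +
    (tail_integral g K + tail_integral f K).
Proof.
move=> mf mg eps0 K0.
have mgf : measurable_fun [set: T] (fun x => g x - f x).
  exact: emeasurable_funB.
have mabs h : measurable_fun [set: T] h -> measurable_fun [set: T] (abse \o h).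
  by move=> mh; exact: measurableT_comp.
set A := [set x | eps%:E <= `|g x - f x|].
have mA : measurable A by exact: (measurable_abse_ge _ mgf).
rewrite (ge0_integral_setID measurableT mA)//; last exact: (mabs _ mgf).
rewrite setTI setTD.
have I1 : \int[mu]_(x in ~` A) `|g x - f x| <= eps%:E * mu [set: T].
  apply: (@le_trans _ _ (\int[mu]_(x in ~` A) eps%:E)).
    apply: ge0_le_integral => //.
    - exact: measurableC.
    - by apply: measurable_funTS; exact: (mabs _ mgf).
    - by move=> x /negP; rewrite -ltNge => /ltW.
  rewrite -integral_cst//; apply: ge0_subset_integral => //.
  exact: measurableC.
have I2 : \int[mu]_(x in A) `|g x - f x| <=
    \int[mu]_(x in A) `|g x| + \int[mu]_(x in A) `|f x|.
  rewrite -ge0_integralD//.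
  - apply: ge0_le_integral => //.
    + by apply: measurable_funTS; exact: (mabs _ mgf).
    + by apply: measurable_funTS; apply: emeasurable_funD; exact: mabs.
    + by move=> x _; exact: lee_abs_sub.
  - by apply: measurable_funTS; exact: mabs.
  - by apply: measurable_funTS; exact: mabs.
rewrite [leLHS]addeC -[leRHS]addeA; apply: leeD => //.
apply: (le_trans I2).
apply: (le_trans (leeD (integral_le_tail mA mg K0)
                       (integral_le_tail mA mf K0))).
rewrite addeACA leeD2r// EFinM -muleA -mule2n.
by rewrite -(mule_natl _ 2).
Qed.

End truncation.

(** * Suprema over measurable sets and the norm of L1 *)

Section total_variation.
Context (R : realType) (d : measure_display) (T : measurableType d)
        (mu : {measure set T -> \bar R}).

Let sup_abs_integral (h : T -> \bar R) : \bar R :=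
  ereal_sup [set `|\int[mu]_(x in S) h x| | S in [set S | measurable S]].

Lemma sup_abs_integral_le_L1 (h : T -> \bar R) : measurable_fun [set: T] h ->
  sup_abs_integral h <= \int[mu]_x `|h x|.
Proof.
move=> mh; apply: ge_ereal_sup => _ [S mS <-].
apply: (le_trans (le_abse_integral _ _ _)) => //; first exact: measurable_funTS.
by apply: ge0_subset_integral => //; exact: measurableT_comp.
Qed.

(** The function [h] has constant sign on the set where it is nonnegative and on
    the complement, so on each of the two the integral of [|h|] is the absolute
    value of the integral of [h]. *)
Lemma L1_le_sup_abs_integral (h : T -> \bar R) : measurable_fun [set: T] h ->
  \int[mu]_x `|h x| <= 2%:E * sup_abs_integral h.
Proof.
move=> mh.
pose P := [set x | 0 <= h x].
have mP : measurable P.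
  by rewrite -[P]setTI; exact: emeasurable_fun_c_infty.
have mPC : measurable (~` P) by exact: measurableC.
have sup_ge S : measurable S ->
    `|\int[mu]_(x in S) h x| <= sup_abs_integral h.
  by move=> mS; apply: ereal_sup_ubound; exists S.
have mabsh : measurable_fun [set: T] (abse \o h) by exact: measurableT_comp.
rewrite (ge0_integral_setID _ measurableT mP)// setTI setTD mule_natl mule2n.
apply: leeD.
  rewrite (eq_integral h) => [|x /[!inE] Px]; last by rewrite gee0_abs.
  exact: le_trans (lee_abs _) (sup_ge _ mP).
have : \int[mu]_(x in ~` P) h x = - \int[mu]_(x in ~` P) `|h x|.
  rewrite -integral_ge0N//; apply: eq_integral => x /[!inE] /negP.
  by rewrite -ltNge => /ltW /lee0_abs ->; rewrite oppeK.
move=> hN; rewrite -[leLHS]gee0_abs ?integral_ge0// -abseN -hN.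
exact: sup_ge.
Qed.

End total_variation.

(** * Convergence in measure *)

Section in_measure.
Context (R : realType) (d : measure_display) (T : measurableType d)
        (mu : {measure set T -> \bar R}).
Variables (f_ : nat -> T -> \bar R) (f : T -> \bar R).
Hypothesis mf_ : forall n, measurable_fun [set: T] (f_ n).
Hypothesis mf : measurable_fun [set: T] f.

Let measurable_dev_ge (e : R) n : measurable [set x | e%:E <= `|f_ n x - f x|].
Proof.
apply: (@measurable_abse_ge _ _ _ (fun x => f_ n x - f x)).
exact: emeasurable_funB.
Qed.

(** By Markov's inequality, [e mu(|f_n - f| >= e)] is at most the distance in
    mean of [f_ n] and [f]. *)
Lemma cvg_L1_in_measure :
  \int[mu]_x `|f_ n x - f x| @[n --> \oo] --> 0 -> cvg_in_measure mu f_ f.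
Proof.
move=> /ge0_cvge0P L1 e e0.
apply/ge0_cvge0P => // c c0.
have ec0 : (0 < e * c)%R by exact: mulr_gt0.
apply: filterS (L1 _ _ ec0) => [n Le|n]; last exact: integral_ge0.
rewrite -(@lee_pmul2l _ e%:E)// -EFinM.
apply: le_trans _ Le.
rewrite -[X in mu X]setTI.
by apply: le_integral_abse => //; exact: emeasurable_funB.
Qed.

(** The deviation sets of the chosen subsequence have summable measures, so that
    almost every point lies in finitely many of them. *)
Lemma cvg_in_measure_ae_subseq :
  {ae mu, forall x, f x \is a fin_num} -> cvg_in_measure mu f_ f ->
  exists2 k : nat -> nat, increasing_seq k &
    {ae mu, forall x, f_ (k n) x @[n --> \oo] --> f x}.
Proof.
move=> ffin f_f.
have /choice[N HN] (j : nat) : exists N, forall n, (N <= n)%N ->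
    mu [set x | j.+1%:R^-1%:E <= `|f_ n x - f x|] <= (1 / (2 ^ j.+1)%:R)%:E.
  have j0 : (0 < j.+1%:R^-1 :> R)%R by rewrite invr_gt0.
  have := f_f _ j0 => /ge0_cvge0P -/(_ _ (1 / (2 ^ j.+1)%:R)%R)[//||M _ HM].
    by rewrite divr_gt0// ltr0n expn_gt0.
  by exists M => n /HM.
(* Partial sums of the [N i + 1] increase strictly and dominate [N]. *)
pose k n := (\sum_(i < n.+1) (N i).+1)%N.
have kS n : k n.+1 = (k n + (N n.+1).+1)%N by rewrite /k big_ord_recr.
have Nk n : (N n <= k n)%N.
  by rewrite /k big_ord_recr/= (leq_trans _ (leq_addl _ _)).
exists k.
  by apply/increasing_seqP => n; rewrite kS ltEnat/= -addn1 leq_add2l.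
pose F j := [set x | j.+1%:R^-1%:E <= `|f_ (k j) x - f x|].
have mF j : measurable (F j) by exact: measurable_dev_ge.
have muF0 : mu (lim_sup_set F) = 0.
  apply: lim_sup_set_cvg0 => //.
  apply: (@le_lt_trans _ _ (\sum_(0 <= j <oo) (1 / (2 ^ j.+1)%:R)%:E)).
    by apply: lee_nneseries => // j _; apply: HN.
  exact: (le_lt_trans (epsilon_trick0 _ _)) (ltry 1%R).
have : {ae mu, forall x, ~ lim_sup_set F x}.
  exists (lim_sup_set F); split=> //; last by move=> x /contrapT.
  apply: bigcap_measurable => // n _.
  exact: bigcup_measurable.
apply: filterS2 ffin => x fx /existsNP[n0 /not_implyP[_ Fx]].
have dev j : (n0 <= j)%N -> `|f_ (k j) x - f x| < j.+1%:R^-1%:E.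
  by move=> n0j; rewrite ltNge; apply/negP => Fjx; apply: Fx; exists j.
have f_fin j : (n0 <= j)%N -> f_ (k j) x \is a fin_num.
  move=> /dev; move: fx; case: (f x) => // r _.
  by case: (f_ _ x).
rewrite -(fineK fx); apply/fine_cvgP; split; first by exists n0.
apply/cvgrPdist_le => e e0; near=> j.
have n0j : (n0 <= j)%N by near: j; exact: nbhs_infty_ge.
rewrite distrC /= -fineB ?f_fin//.
rewrite -lee_fin (@le_trans _ _ j.+1%:R^-1%:E)//; last first.
  by rewrite lee_fin ltW//; near: j; exact: (near_infty_natSinv_lt (PosNum e0)).
rewrite -[`|_|%:E]/(`|_%:E|) fineK ?fin_numB ?f_fin//.
exact/ltW/dev.
Unshelve. all: by end_near. Qed.

End in_measure.

(** * Vitali's convergence theorem *)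

Section vitali.
Context (R : realType) (d : measure_display) (T : measurableType d)
        (mu : {measure set T -> \bar R}).
Variables (f_ : nat -> T -> \bar R) (f : T -> \bar R).
Hypothesis f_n_int : forall n, mu.-integrable [set: T] (f_ n).
Hypothesis f_int : mu.-integrable [set: T] f.

Let mf_ n : measurable_fun [set: T] (f_ n) := measurable_int _ (f_n_int n).
Let mf : measurable_fun [set: T] f := measurable_int _ f_int.

Lemma cvg_L1_total_variation :
  \int[mu]_x `|f_ n x - f x| @[n --> \oo] --> 0 <->
  ereal_sup [set `|\int[mu]_(x in S) f_ n x - \int[mu]_(x in S) f x|
               | S in [set S : set T | measurable S]] @[n --> \oo] --> 0.
Proof.
have supE n :
    ereal_sup [set `|\int[mu]_(x in S) f_ n x - \int[mu]_(x in S) f x|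
                 | S in [set S : set T | measurable S]] =
    ereal_sup [set `|\int[mu]_(x in S) (f_ n x - f x)|
                 | S in [set S : set T | measurable S]].
  congr ereal_sup; apply: eq_imagel => S mS.
  rewrite integralB//; first exact: integrableS (f_n_int n).
  exact: integrableS f_int.
under [X in _ <-> (X @ _ --> _)]eq_fun do rewrite supE.
have mf_f n : measurable_fun [set: T] (fun x => f_ n x - f x).
  exact: emeasurable_funB.
have sup0 n : 0 <= ereal_sup [set `|\int[mu]_(x in S) (f_ n x - f x)|
                 | S in [set S : set T | measurable S]].
  by apply: ereal_sup_ubound; exists set0 => //=; rewrite integral_set0 abse0.
split=> cvg0.
- apply/ge0_cvge0P => // e e0.
  move/ge0_cvge0P : cvg0 => /(_ _ e e0)[n|N _ HN]; first exact: integral_ge0.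
  exists N => // n /HN; apply: le_trans; exact: sup_abs_integral_le_L1.
- apply/ge0_cvge0P => [n|e e0]; first exact: integral_ge0.
  have e20 : (0 < e / 2)%R by lra.
  move/ge0_cvge0P : cvg0 => /(_ _ _ e20)[//|N _ HN].
  exists N => // n /HN le.
  apply: (le_trans (L1_le_sup_abs_integral _ (mf_f n))).
  have -> : e%:E = 2%:E * (e / 2)%:E :> \bar R by rewrite -EFinM; congr _%:E; lra.
  by rewrite lee_pmul2l.
Qed.

(** The perturbation bound controls the tails of all [f_ n] with [n] large by the
    tail of [f]; the remaining [f_ n] are finitely many. *)
Lemma cvg_L1_uniformly_integrable :
  \int[mu]_x `|f_ n x - f x| @[n --> \oo] --> 0 -> uniformly_integrable mu f_.
Proof.
move=> /ge0_cvge0P L1; apply/ge0_cvge0P => [K|e e0].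
  apply: ereal_sup_ge; exists (tail_integral mu (f_ 0) K); first by exists 0%N.
  exact: tail_integral_ge0.
have e60 : (0 < e / 6)%R by lra.
have [n|N _ HN] := L1 _ _ e60; first exact: integral_ge0.
have e20 : (0 < e / 2)%R by lra.
have [K0 K00 HK0] := tail_integral_cvg0 f_int e20.
have /choice[K HK] (n : nat) :
    exists K : R, (0 < K)%R /\ tail_integral mu (f_ n) K <= e%:E.
  by have [K ? ?] := tail_integral_cvg0 (f_n_int n) e0; exists K.
have sumK m : (0 <= \sum_(i < m) K i)%R.
  by apply: sumr_ge0 => i _; exact: ltW (HK i).1.
(* The sum of the [K i] bounds all the heights of the first [N] functions. *)
near=> L.
have LK : (2 * K0 + \sum_(i < N) K i <= L)%R.
  by near: L; apply: nbhs_pinfty_ge; rewrite num_real.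
apply: ge_ereal_sup => _ [n _ <-]; rewrite -/(tail_integral mu (f_ n) L).
have [Nn|nN] := leqP N n.
  apply: (le_trans (tail_integral_perturb _ _ mf (mf_ n))).
  have -> : e%:E = 3%:E * (e / 6)%:E + (e / 2)%:E :> \bar R.
    by rewrite -EFinM -EFinD; congr _%:E; lra.
  apply: leeD; first by rewrite lee_pmul2l//; exact: HN.
  apply: le_trans HK0; apply: le_tail_integral => //.
  have := sumK N; lra.
apply: le_trans (HK n).2; apply: le_tail_integral => //.
apply: le_trans LK; rewrite (bigD1 (Ordinal nN))//=.
have : (0 <= \sum_(i < N | i != Ordinal nN) K i)%R.
  by apply: sumr_ge0 => i _; exact: ltW (HK i).1.
lra.
Unshelve. all: by end_near. Qed.

(** In [L1_le_tails], each of the four terms is made at most [e / 4]. *)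
Lemma in_measure_uniformly_integrable_cvg_L1 : mu [set: T] < +oo ->
  cvg_in_measure mu f_ f -> uniformly_integrable mu f_ ->
  \int[mu]_x `|f_ n x - f x| @[n --> \oo] --> 0.
Proof.
move=> muoo f_f ui; apply/ge0_cvge0P => [n|e e0]; first exact: integral_ge0.
pose M := fine (mu [set: T]).
have ME : mu [set: T] = M%:E by rewrite fineK// ge0_fin_numE.
have M0 : (0 <= M)%R by exact: fine_ge0.
have e40 : (0 < e / 4)%R by lra.
(* Adding 1 keeps [eps] meaningful for the zero measure. *)
pose eps := (e / 4 / (M + 1))%R.
have eps0 : (0 < eps)%R by rewrite divr_gt0//; lra.
have epsM : (eps * M <= e / 4)%R.
  by rewrite /eps mulrAC ler_pdivrMr ?ler_pM2l//; lra.
have [K1 K10 HK1] := tail_integral_cvg0 f_int e40.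
have [K [K0 K1K HK]] : exists K : R, [/\ (0 < K)%R, (K1 <= K)%R &
    forall n, tail_integral mu (f_ n) K <= (e / 4)%:E].
  move/ge0_cvge0P : ui => /(_ _ _ e40) [L|B [_ HB]].
    apply: ereal_sup_ge; exists (tail_integral mu (f_ 0) L); first by exists 0%N.
    exact: tail_integral_ge0.
  exists (K1 + `|B| + 1)%R; have B0 := normr_ge0 B; split; [lra|lra|move=> n].
  apply: (le_trans _ (HB _ _)).
    by apply: ereal_sup_ubound; exists n.
  by have := ler_norm B; lra.
have c0 : (0 < e / 4 / (2 * K))%R by rewrite divr_gt0//; lra.
move/ge0_cvge0P : (f_f _ eps0) => /(_ _ _ c0)[//|N _ HN].
exists N => // n /HN /= muA.
apply: (le_trans (L1_le_tails mu mf (mf_ n) (ltW eps0) (ltW K0))).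
have -> : e%:E = (e / 4)%:E + (e / 4)%:E + ((e / 4)%:E + (e / 4)%:E) :> \bar R.
  by rewrite -!EFinD; congr _%:E; lra.
apply: leeD; apply: leeD => //.
- by rewrite ME -EFinM lee_fin.
- have -> : (e / 4)%:E = (2 * K)%:E * (e / 4 / (2 * K))%:E :> \bar R.
    by rewrite -EFinM; congr _%:E; rewrite [RHS]mulrC divfK// gt_eqF//; lra.
  by rewrite lee_pmul2l// lte_fin; lra.
- exact: le_trans (le_tail_integral mu mf K1K) HK1.
Qed.

End vitali.

(** * The characterization *)

Unset Implicit Arguments.

Theorem corollary1p9 (R : realType) (d : measure_display)
    (T : measurableType d) (mu : {finite_measure set T -> \bar R})
    (f : T -> \bar R) (f_ : nat -> T -> \bar R)
    (f_int : mu.-integrable [set: T] f)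
    (f_n_int : forall n : nat, mu.-integrable [set: T] (f_ n)) :
  (ereal_sup [set `|\int[mu]_(x in S) f_ n x - \int[mu]_(x in S) f x|
               | S in [set S : set T | measurable S]] @[n --> \oo] --> 0
   <-> cvg_in_measure mu f_ f /\ uniformly_integrable mu f_)
  /\
  (cvg_in_measure mu f_ f ->
    exists2 k : nat -> nat, increasing_seq k &
      {ae mu, forall x, f_ (k n) x @[n --> \oo] --> f x}).
Proof.
have mf_ n := measurable_int _ (f_n_int n).
have mf := measurable_int _ f_int.
split.
  split=> [/(cvg_L1_total_variation f_n_int f_int) L1|[f_f ui]].
    split; first exact: cvg_L1_in_measure.
    exact: cvg_L1_uniformly_integrable L1.
  apply/(cvg_L1_total_variation f_n_int f_int).
  apply: in_measure_uniformly_integrable_cvg_L1 => //.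
  by rewrite -ge0_fin_numE// fin_num_measure.
apply: cvg_in_measure_ae_subseq => //.
by apply: filterS (integrable_ae measurableT f_int) => x; exact.
Qed.
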